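(* Let $\mathbb{F}$ be a division ring, $n$ a positive integer, $\sigma:\mathbb{F}\to\mathbb{F}^{n\times n}$ a ring morphism, $\delta:\mathbb{F}\to\mathbb{F}^n$ a $\sigma$-derivation and $\mathbf{a}\in\mathbb{F}^n$. Assume that $M=\dim^R_{K_{\mathbf{a}}}(\mathbb{F})<\infty$ and let $\boldsymbol\beta=(\beta_1,\dots,\beta_M)\in\mathbb{F}^M$ be an ordered right basis of $\mathbb{F}$ over $K_{\mathbf{a}}$. Then, for all $F^{\mathcal{D}_{\mathbf{a}}},G^{\mathcal{D}_{\mathbf{a}}}\in\mathbb{F}[\mathcal{D}_{\mathbf{a}}]$, $$\left(F^{\mathcal{D}_{\mathbf{a}}}\circ G^{\mathcal{D}_{\mathbf{a}}}\right)(\boldsymbol\beta)=F^{\mathcal{D}_{\mathbf{a}}}(\boldsymbol\beta)\star G^{\mathcal{D}_{\mathbf{a}}}(\boldsymbol\beta),$$ where $\star$ is the matrix product on $\mathbb{F}^M$ with respect to $\boldsymbol\beta$.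
   Context: Rings are associative with identity, not necessarily commutative, and ring morphisms preserve identities. $\mathbb{F}^n$ denotes column vectors. A map $\delta:\mathbb{F}\to\mathbb{F}^n$ is a $\sigma$-derivation if $\delta(a+b)=\delta(a)+\delta(b)$ and $\delta(ab)=\sigma(a)\delta(b)+\delta(a)b$ for all $a,b\in\mathbb{F}$. Linearized polynomials: let $\mathcal{M}$ be the free monoid on variables $x_1,\dots,x_n$. Define $\mathcal{D}_{\mathbf{a}}:\mathbb{F}\to\mathbb{F}^n$ by $\mathcal{D}_{\mathbf{a}}(\beta)=\sigma(\beta)\mathbf{a}+\delta(\beta)$. Define maps $\mathcal{D}_{\mathbf{a}}^{\mathfrak{m}}:\mathbb{F}\to\mathbb{F}$ for $\mathfrak{m}\in\mathcal{M}$ recursively by $\mathcal{D}_{\mathbf{a}}^{1}=\mathrm{Id}$ and $\mathcal{D}_{\mathbf{a}}^{x_i\mathfrak{m}}(\beta)=$ the $i$-th component of $\mathcal{D}_{\mathbf{a}}(\mathcal{D}_{\mathbf{a}}^{\mathfrak{m}}(\beta))$. $\mathbb{F}[\mathcal{D}_{\mathbf{a}}]$ is the left $\mathbb{F}$-vector space of maps $\mathbb{F}\to\mathbb{F}$ generated by $\{\mathcal{D}_{\mathbf{a}}^{\mathfrak{m}}\mid\mathfrak{m}\in\mathcal{M}\}$; its elements are written $F^{\mathcal{D}_{\mathbf{a}}}=\sum_{\mathfrak{m}}F_{\mathfrak{m}}\mathcal{D}_{\mathbf{a}}^{\mathfrak{m}}$ (finite sums, $F_{\mathfrak{m}}\in\mathbb{F}$).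 A map $f:\mathbb{F}\to\mathbb{F}$ is applied to a tuple componentwise: $f(\boldsymbol\beta)=(f(\beta_1),\dots,f(\beta_M))$. Centralizer: $K_{\mathbf{a}}=\{\beta\in\mathbb{F}\mid\mathcal{D}_{\mathbf{a}}(\beta)=\mathbf{a}\beta\}$, a division subring of $\mathbb{F}$; $\dim^R$ is right dimension. Matrix product: $\mu_{\boldsymbol\beta}:\mathbb{F}^M\to K_{\mathbf{a}}^{M\times M}$ sends $\mathbf{x}=(x_1,\dots,x_M)$ to the matrix whose $(i,j)$ entry is $x_j^i$, where $x_j^1,\dots,x_j^M\in K_{\mathbf{a}}$ are the unique scalars with $x_j=\sum_{i=1}^M\beta_i x_j^i$. It is a bijection, and $\mathbf{x}\star\mathbf{y}=\mu_{\boldsymbol\beta}^{-1}(\mu_{\boldsymbol\beta}(\mathbf{x})\mu_{\boldsymbol\beta}(\mathbf{y}))$. *)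

(* Defs.v *)
From HB Require Import structures.
From mathcomp Require Import all_boot all_algebra.

Set Implicit Arguments.
Unset Strict Implicit.
Unset Printing Implicit Defensive.

Import GRing.Theory.
Local Open Scope ring_scope.

(* 1 != 0 is part of unitRingType, so the zero ring is excluded. *)
Definition division_ring (F : unitRingType) : Prop :=
  forall x : F, x != 0 -> x \is a GRing.unit.

(* A column times a scalar on the right; matrix.v only provides the left
   action, which differs since F need not be commutative. *)
Definition rscale (F : unitRingType) (n : nat) (v : 'cV[F]_n) (b : F) :
  'cV[F]_n := \col_i (v i 0 * b).

Record sderivation (F : unitRingType) (n : nat) (sigma : F -> 'M[F]_n) :=
  SDerivation {
    sder_fun :> F -> 'cV[F]_n;
    sderD : forall a b, sder_fun (a + b) = sder_fun a + sder_fun b;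
    sderM : forall a b,
      sder_fun (a * b) = sigma a *m sder_fun b + rscale (sder_fun a) b
  }.

Section Operators.
Variables (F : unitRingType) (n : nat) (sigma : {rmorphism F -> 'M[F]_n}).
Variables (delta : sderivation sigma) (a : 'cV[F]_n).

Definition Dop (b : F) : 'cV[F]_n := sigma b *m a + delta b.

(* A word i :: m in the letters 'I_n stands for the monomial x_i m of the free
   monoid, so the head letter is applied last. *)
Fixpoint Dmon (m : seq 'I_n) (b : F) : F :=
  if m is i :: m' then Dop (Dmon m' b) i 0 else b.

(* Membership in F[D_a]. Only coefficients at words in s are used, and s has no
   repetitions, so this is a sum of F_m D_a^m with F_m of finite support. *)
Definition linearized (f : F -> F) : Prop :=
  exists (s : seq (seq 'I_n)) (c : seq 'I_n -> F),
    uniq s /\ f =1 (fun b => \sum_(m <- s) c m * Dmon m b).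

Definition centralizer : {pred F} := [pred b | Dop b == rscale a b].

Lemma sder1 : delta 1 = 0.
Proof.
have := sderM delta 1 1; rewrite mulr1 rmorph1 mul1mx.
have -> : rscale (delta 1) 1 = delta 1 by apply/colP=> i; rewrite !mxE mulr1.
by move/eqP; rewrite -subr_eq0 opprD addNKr oppr_eq0 => /eqP.
Qed.

Lemma DopB b c : Dop (b - c) = Dop b - Dop c.
Proof.
have dB : delta (b - c) = delta b - delta c.
  by apply/eqP; rewrite eq_sym subr_eq -sderD subrK.
by rewrite /Dop rmorphB mulmxBl dB opprD addrACA.
Qed.

Lemma DopM b c : c \in centralizer -> Dop (b * c) = rscale (Dop b) c.
Proof.
rewrite inE => /eqP Dc.
have -> : Dop (b * c) = sigma b *m Dop c + rscale (delta b) c.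
  by rewrite /Dop rmorphM sderM mulmxDr -mulmxA addrA.
rewrite Dc; apply/colP=> i; rewrite !mxE mulrDl mulr_suml; congr (_ + _).
by apply: eq_bigr => j _; rewrite !mxE mulrA.
Qed.

Lemma rscaleA (v : 'cV[F]_n) b c : rscale (rscale v b) c = rscale v (b * c).
Proof. by apply/colP=> i; rewrite !mxE mulrA. Qed.

Lemma rscale1 (v : 'cV[F]_n) : rscale v 1 = v.
Proof. by apply/colP=> i; rewrite !mxE mulr1. Qed.

Lemma centralizer_divring_closed : divring_closed centralizer.
Proof.
have c1 : 1 \in centralizer.
  by rewrite inE /Dop rmorph1 mul1mx sder1 addr0 rscale1.
have cM b c : b \in centralizer -> c \in centralizer -> b * c \in centralizer.
  move=> Kb Kc; rewrite inE (DopM _ Kc).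
  by move: Kb; rewrite inE => /eqP->; rewrite rscaleA.
have cV b : b \in centralizer -> b^-1 \in centralizer.
  move=> Kb; have [Ub|/invr_out->//] := boolP (b \is a GRing.unit).
  have := DopM b^-1 Kb; rewrite mulVr //.
  move: c1; rewrite inE => /eqP->; rewrite rscale1 => Da.
  by rewrite inE [in rscale a _]Da rscaleA divrr // rscale1.
split=> // [b c Kb Kc|b c Kb Kc]; last exact/cM/cV.
move: Kb Kc; rewrite !inE DopB => /eqP-> /eqP->.
by apply/eqP/colP=> i; rewrite !mxE mulrBr.
Qed.

HB.instance Definition _ :=
  GRing.isDivringClosed.Build F centralizer centralizer_divring_closed.

Record Ka := KaElt { Kaval :> F; KavalP : Kaval \in centralizer }.

HB.instance Definition _ := [isSub for Kaval].
HB.instance Definition _ := [Choice of Ka by <:].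
HB.instance Definition _ := [SubChoice_isSubUnitRing of Ka by <:].

Lemma Ka_division_ring : division_ring F -> division_ring Ka.
Proof.
move=> divF b b0; apply/unitrP; have Ub : val b \is a GRing.unit.
  by apply: divF; rewrite -(rmorph0 (val : Ka -> F)) (inj_eq val_inj).
exists (KaElt (rpredVr (KavalP b))).
by split; apply/val_inj; rewrite rmorphM rmorph1 /= ?mulVr ?mulrV.
Qed.

Section RightBasis.
Variables (M : nat) (beta : 'rV[F]_M).

Definition rcomb (c : 'cV[Ka]_M) : F := \sum_i beta 0 i * Kaval (c i 0).

(* beta is an ordered right basis of F over K_a; in particular M is the right
   dimension of F over K_a. *)
Definition right_basis : Prop :=
  (forall c : 'cV[Ka]_M, rcomb c = 0 -> c = 0) /\
  (forall x : F, exists c : 'cV[Ka]_M, rcomb c = x).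

Lemma rcombB c d : rcomb (c - d) = rcomb c - rcomb d.
Proof.
rewrite /rcomb -sumrB; apply: eq_bigr => i _.
by rewrite !mxE -mulrBr; congr (_ * _); exact: (rmorphB (val : Ka -> F)).
Qed.

Hypothesis hbeta : right_basis.

Lemma rcomb_inj : injective rcomb.
Proof.
move=> c d /eqP; rewrite -subr_eq0 -rcombB => /eqP/(proj1 hbeta)/eqP.
by rewrite subr_eq0 => /eqP.
Qed.

Lemma rcoord_exists (x : F) : exists c : 'cV[Ka]_M, rcomb c == x.
Proof. by have [c <-] := proj2 hbeta x; exists c. Qed.

Definition rcoord (x : F) : 'cV[Ka]_M := xchoose (rcoord_exists x).

Lemma rcoordK : cancel rcoord rcomb.
Proof. by move=> x; apply/eqP/(xchooseP (rcoord_exists x)). Qed.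

Lemma rcombK : cancel rcomb rcoord.
Proof. by move=> c; apply: rcomb_inj; rewrite rcoordK. Qed.

Definition mu (x : 'rV[F]_M) : 'M[Ka]_M :=
  \matrix_(i, j) rcoord (x 0 j) i 0.

Lemma mu_inj : injective mu.
Proof.
move=> x y /matrixP exy; apply/rowP=> j; rewrite -[LHS]rcoordK -[RHS]rcoordK.
by congr rcomb; apply/colP=> i; have := exy i j; rewrite !mxE.
Qed.

Lemma mu_surj (A : 'M[Ka]_M) : exists x, mu x == A.
Proof.
exists (\row_j rcomb (col j A)); apply/eqP/matrixP=> i j.
by rewrite !mxE rcombK mxE.
Qed.

Definition mu_inv (A : 'M[Ka]_M) : 'rV[F]_M := xchoose (mu_surj A).

Lemma mu_invK : cancel mu_inv mu.
Proof. by move=> A; apply/eqP/(xchooseP (mu_surj A)). Qed.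

Lemma muK : cancel mu mu_inv.
Proof. by move=> x; apply: mu_inj; rewrite mu_invK. Qed.

Definition star (x y : 'rV[F]_M) : 'rV[F]_M := mu_inv (mu x *m mu y).

End RightBasis.
End Operators.

(* Main.v *)
(** Every operator in F[D_a] is right K_a-linear, because D_a is. Hence mu sends
    f(beta) to the matrix of f in the basis beta, and the matrix of a composite
    is the product of the matrices. *)
Require Import Defs.
From mathcomp Require Import all_boot all_algebra.
Import GRing.Theory.
Local Open Scope ring_scope.

Section RightLinearity.
Context {F : unitRingType} {n : nat} {sigma : {rmorphism F -> 'M[F]_n}}.
Context {delta : sderivation sigma} {a : 'cV[F]_n}.

(** Let [c] be the coordinate column of $g(\beta_j)$. Right $K_a$-linearity of [f]
    ([linearized_rcomb]) gives $f(g(\beta_j))=\sum_i f(\beta_i)c_i$. Expanding each $f(\beta_i)$ in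
    the basis ([rcomb_mulmx]) shows that its coordinate column is $\mu(f(\beta))c$, which is column
    $j$ of the matrix product. *)

Lemma DmonB m : {morph Dmon delta a m : b c / b - c}.
Proof. by elim: m => //= i m IH b c; rewrite IH DopB !mxE. Qed.

(** Since $D_a(k)=ak$, [DopM] lets [k] pass out on the right of $D_a$, one letter of the word at a
    time. *)
Lemma DmonM m b k : k \in centralizer delta a ->
  Dmon delta a m (b * k) = Dmon delta a m b * k.
Proof. by move=> Kk; elim: m => //= i m ->; rewrite (DopM _ Kk) mxE. Qed.

Lemma linearizedB f : linearized delta a f -> {morph f : b c / b - c}.
Proof.
case=> s [c [_ fE]] x y; rewrite !fE -sumrB.
by apply: eq_bigr => m _; rewrite DmonB mulrBr.
Qed.

Lemma linearizedM f b k : linearized delta a f -> k \in centralizer delta a ->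
  f (b * k) = f b * k.
Proof.
case=> s [c [_ fE]] Kk; rewrite !fE mulr_suml.
by apply: eq_bigr => m _; rewrite (DmonM _ _ _ Kk) mulrA.
Qed.

Lemma linearized_rcomb f (M : nat) (beta : 'rV[F]_M) (c : 'cV[Ka delta a]_M) :
  linearized delta a f -> f (rcomb beta c) = rcomb (map_mx f beta) c.
Proof.
move=> fL; have fB := linearizedB _ fL.
(* Additivity is recovered from differences, via $x+y=x-(0-y)$. *)
have f0 : f 0 = 0 by rewrite -[X in f X](subrr 0) fB subrr.
have fD : {morph f : x y / x + y}.
  by move=> x y; rewrite -[y in LHS]opprK fB -[- y]sub0r !fB f0 sub0r opprK.
rewrite /rcomb (big_morph f fD f0); apply: eq_bigr => i _.
by rewrite (linearizedM _ _ _ fL (KavalP _)) mxE.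
Qed.

(** This is the associativity $\beta(Ac)=(\beta A)c$, with [beta] over [F] and the other factors
    over $K_a$. *)
Lemma rcomb_mulmx (M N : nat) (beta : 'rV[F]_M) (A : 'M[Ka delta a]_(M, N))
    (c : 'cV[Ka delta a]_N) :
  rcomb beta (A *m c) = rcomb (\row_j rcomb beta (col j A)) c.
Proof.
rewrite /rcomb; under [RHS]eq_bigr do rewrite mxE mulr_suml.
rewrite exchange_big; apply: eq_bigr => i _ /=.
rewrite mxE -[Kaval _]/(val _) raddf_sum mulr_sumr; apply: eq_bigr => j _.
by rewrite mxE -mulrA; congr (_ * _); exact: (rmorphM (val : Ka delta a -> F)).
Qed.

Lemma rcomb_col_mu (M : nat) (beta : 'rV[F]_M)
    (hbeta : right_basis delta a beta) (x : 'rV[F]_M) j :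
  rcomb beta (col j (mu hbeta x)) = x 0 j.
Proof.
by rewrite -[RHS](rcoordK hbeta); congr rcomb; apply/colP=> i; rewrite !mxE.
Qed.

End RightLinearity.

Theorem theorem7 (F : unitRingType) (hF : division_ring F)
  (n : nat) (hn : (0 < n)%N)
  (sigma : {rmorphism F -> 'M[F]_n}) (delta : sderivation sigma)
  (a : 'cV[F]_n)
  (M : nat) (beta : 'rV[F]_M) (hbeta : right_basis delta a beta)
  (f g : F -> F) (hf : linearized delta a f) (hg : linearized delta a g) :
  map_mx (f \o g) beta = star hbeta (map_mx f beta) (map_mx g beta).
Proof.
rewrite -[LHS](muK hbeta); congr mu_inv; apply/matrixP=> i j.
(* Columns are compared through the elements of [F] they represent, as coordinates are unique. *)
have /colP/(_ i) : col j (mu hbeta (map_mx (f \o g) beta)) =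
    mu hbeta (map_mx f beta) *m col j (mu hbeta (map_mx g beta)).
  apply: (rcomb_inj hbeta); rewrite rcomb_mulmx rcomb_col_mu !mxE /=.
  have -> : f (g (beta 0 j)) =
      f (rcomb beta (col j (mu hbeta (map_mx g beta)))).
    by rewrite rcomb_col_mu mxE.
  rewrite (linearized_rcomb _ _ _ _ hf); congr rcomb.
  by apply/rowP=> k; rewrite mxE rcomb_col_mu.
by rewrite !colE mulmxA -!colE [LHS]mxE [RHS]mxE.
Qed.
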